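(* Let $n\ge 1$, let $\mathcal{G}$ be an abelian sub-semigroup of $MA(n,\mathbb{C})$ and $G=\Phi(\mathcal{G})$. Let $P\in\Phi(GA(n,\mathbb{C}))$ be such that $P^{-1}GP\subset\mathcal{K}_{\eta,r}(\mathbb{C})$, where $1\le r\le n+1$ and $\eta=(n_1,\dots,n_r)$ is an $r$-tuple of positive integers with $n_1+\dots+n_r=n+1$. If $\mathcal{G}$ is generated by $2n-r+1$ commuting invertible affine maps, then it has no dense orbit.
   Context: $MA(n,\mathbb{C})$ is the set of affine maps $f=(A,a):\mathbb{C}^n\to\mathbb{C}^n$, $f(x)=Ax+a$, with $A\in M_n(\mathbb{C})$, $a\in\mathbb{C}^n$, a semigroup under composition; $GA(n,\mathbb{C})$ is the group of its invertible elements. $\Phi(A,a)=\begin{bmatrix}1&0\\ a&A\end{bmatrix}\in M_{n+1}(\mathbb{C})$. $\mathbb{T}_m(\mathbb{C})$ is the set of $m\times m$ lower triangular complex matrices all of whose diagonal entries are equal to one another, and $\mathcal{K}_{\eta,r}(\mathbb{C})=\mathbb{T}_{n_1}(\mathbb{C})\oplus\dots\oplus\mathbb{T}_{n_r}(\mathbb{C})$ (block diagonal matrices). The orbit of $v\in\mathbb{C}^n$ is $\mathcal{G}(v)=\{f(v):f\in\mathcal{G}\}$; ''dense'' means dense in $\mathbb{C}^n$. *)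

(* Defs.v *)
From HB Require Import structures.
From mathcomp Require Import all_boot all_order all_algebra.
From mathcomp Require Import complex.
From mathcomp Require Import all_classical all_reals all_analysis.

Set Implicit Arguments.
Unset Strict Implicit.
Unset Printing Implicit Defensive.

Import Order.TTheory GRing.Theory Num.Theory.
Import numFieldNormedType.Exports.

Local Open Scope classical_set_scope.
Local Open Scope ring_scope.
Local Open Scope complex_scope.

(* The usual topology of the complex plane, given by the complex modulus; it
   makes 'cV[R[i]]_n a topological space with the product topology. *)
HB.instance Definition _ (R : realType) :=
  PseudoPointedMetric.copy R[i] (R[i])^o.

(* The pair (A, a) stands for the affine map x |-> A x + a of C^n; it is
   determined by that map, see [aff_app_inj]. *)
Definition MA (R : realType) (n : nat) : Type := ('M[R[i]]_n * 'cV[R[i]]_n)%type.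

Section Affine.
Variables (R : realType) (n : nat).
Implicit Types (f g : MA R n) (v : 'cV[R[i]]_n) (S : set (MA R n)).

Definition aff_app f v : 'cV[R[i]]_n := f.1 *m v + f.2.

Definition aff_comp f g : MA R n := (f.1 *m g.1, f.1 *m g.2 + f.2).

Definition aff_id : MA R n := (1%:M, 0).

Lemma aff_app_comp f g : aff_app (aff_comp f g) = aff_app f \o aff_app g.
Proof. by apply/funext => v /=; rewrite /aff_app /= mulmxDr mulmxA addrA. Qed.

Lemma aff_app_id : aff_app aff_id = id.
Proof. by apply/funext => v; rewrite /aff_app /= mul1mx addr0. Qed.

Lemma aff_app_inj : injective aff_app.
Proof.
move=> [A a] [B b] /= eqAB.
have eq0 v : A *m v + a = B *m v + b := congr1 (@^~ v) eqAB.
have eqab : a = b by have := eq0 0; rewrite !mulmx0 !add0r.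
congr (_, _) => //; apply/matrixP => i j.
have := eq0 (delta_mx j 0); rewrite eqab => /addIr.
by rewrite -!colE => /matrixP/(_ i 0); rewrite !mxE.
Qed.

Definition GA : set (MA R n) :=
  [set f | exists g, aff_comp f g = aff_id /\ aff_comp g f = aff_id].

Definition subsemigroup S := forall f g, S f -> S g -> S (aff_comp f g).

Definition abelian_semigroup S :=
  subsemigroup S /\
  forall f g, S f -> S g -> aff_comp f g = aff_comp g f.

Definition generated_by S (gens : set (MA R n)) :=
  S = smallest subsemigroup gens.

Definition aff_orbit S v : set 'cV[R[i]]_n := [set aff_app f v | f in S].

Definition Phi f : 'M[R[i]]_(1 + n) := block_mx 1%:M 0 f.2 f.1.

End Affine.

Arguments GA R n : clear implicits.

(* [is_trig_mx] is the predicate for lower triangular matrices. *)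
Definition TT (R : realType) (m : nat) : set 'M[R[i]]_m :=
  [set A | is_trig_mx A /\ forall i j, A i i = A j j].

(* [castmx] only transports the size along the equation n_1 + ... + n_r = m. *)
Definition KK (R : realType) (r m : nat) (eta : 'I_r -> nat)
    (sum_eta : (\sum_(k < r) eta k)%N = m) : set 'M[R[i]]_m :=
  [set M | exists B : forall k, 'M[R[i]]_(eta k),
     (forall k, TT (B k)) /\ M = castmx (sum_eta, sum_eta) (\mxdiag_k B k)].

(* Main.v *)
Require Import Defs.
From mathcomp Require Import all_boot all_order all_algebra.
From mathcomp Require Import complex.
From mathcomp Require Import all_classical all_reals all_analysis.
From mathcomp Require Import ring lra zify.

(** The orbit is tested against logarithms: there are as many of them as there
    are generators, and that is one too few for density.

    Suppose that the orbit of v is dense, and put w = P^-1 (1, v). The matrices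
    X = P^-1 Phi(f) P, for f in G, commute, are block diagonal and lower
    triangular with one diagonal value per block, and the vectors X w are
    dense in the affine hyperplane of the vectors with first coordinate 1.
    Therefore w is cyclic, and X |-> X w identifies the commutant A of these
    matrices with C^(n+1) ([dual_basis]). In particular A is commutative.

    An element X of A with nonzero diagonal is D (1 + U), where D is its
    diagonal part, constant on blocks, and U is strictly lower triangular. The
    maps X |-> ln |X_ff|, for f the first index of a block, and
    X |-> log (1 + U) turn products into sums ([log_coordM]). The first
    diagonal entry is 1 when X comes from G, so the moduli give r - 1 functions,
    whereas log (1 + U) w vanishes at the first index of every block and is
    otherwise an arbitrary vector, which gives 2 (n + 1 - r) more. The arguments
    of the diagonal entries give none, being defined modulo 2 pi only. In all
    this makes 2 n - r + 1 additive real functions, which is the number of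
    generators.

    Given q vectors in R^q, some nonzero linear form is integral on all of them
    ([integral_functional]). So some combination h of the additive functions,
    with coefficients not all zero, is integral on the generators, hence on
    the matrices of all elements of G. But h is equal to 1/2 at some X0 in A
    whose first diagonal entry is 1 ([log_coord_half]), and it is continuous
    there. Since X0 w is a limit of vectors X w with X coming from G, some such
    X has h(X) in ]0, 1[: a contradiction ([no_dense_commuting_orbit]). *)

Set Implicit Arguments.
Unset Strict Implicit.
Unset Printing Implicit Defensive.

Import Order.TTheory GRing.Theory Num.Theory.
Import numFieldNormedType.Exports.

Local Open Scope ring_scope.
Local Open Scope complex_scope.

(** * The logarithm of a unipotent matrix *)

(** The polynomial in s with value 'C(s, k) at each natural number s. *)
Definition binpoly (F : numFieldType) (k : nat) : {poly F} :=
  k`!%:R^-1 *: \prod_(i < k) ('X - i%:R%:P).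

Lemma horner_binpoly (F : numFieldType) (k s : nat) :
  (binpoly F k).[s%:R] = 'C(s, k)%:R.
Proof.
have fact_neq0 : k`!%:R != 0 :> F by rewrite pnatr_eq0 -lt0n fact_gt0.
apply: (mulfI fact_neq0).
rewrite hornerZ mulVKf // -natrM mulnC bin_ffact horner_prod ffact_prod.
under eq_bigr do rewrite hornerXsubC.
case: (leqP k s) => [le_ks | lt_sk].
  rewrite natr_prod; apply: eq_bigr => i _.
  by rewrite natrB // ltnW // (leq_trans (ltn_ord i)).
rewrite (bigD1 (Ordinal lt_sk)) //= subrr mul0r.
by rewrite (bigD1 (Ordinal lt_sk)) //= subnn mul0n.
Qed.

Lemma binpoly0 (F : numFieldType) : binpoly F 0 = 1.
Proof. by rewrite /binpoly big_ord0 invr1 scale1r. Qed.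

Lemma binpoly1 (F : numFieldType) : binpoly F 1 = 'X.
Proof. by rewrite /binpoly big_ord1 invr1 scale1r subr0. Qed.

(** This is log (1 + A) when A^(n+1) = 0, as the coefficient of s in
    (1 + A)^s = sum_k 'C(s, k) A^k. *)
Definition nlog (F : numFieldType) (n : nat) (A : 'M[F]_n.+1) : 'M[F]_n.+1 :=
  \sum_(k < n.+2) (binpoly F k)`_1 *: A ^+ k.

(** (1 + A)^s as a matrix of polynomials in the exponent s. *)
Definition powmx (F : numFieldType) (n : nat) (A : 'M[F]_n.+1) :
    'M[{poly F}]_n.+1 :=
  \matrix_(i, j) \sum_(k < n.+2) (A ^+ k) i j *: binpoly F k.

Lemma horner_powmx (F : numFieldType) (n : nat) (A : 'M[F]_n.+1) i j (s : nat) :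
  A ^+ n.+1 = 0 -> (powmx A i j).[s%:R] = ((1 + A) ^+ s) i j.
Proof.
move=> A0; have Ak0 k : (n < k)%N -> A ^+ k = 0.
  by move=> lt_nk; rewrite -(subnKC lt_nk) exprD A0 mul0r.
rewrite mxE horner_sum addrC exprD1n summxE.
pose a k := 'C(s, k)%:R * (A ^+ k) i j.
have split_sum N M : (forall k, (N <= k)%N -> a k = 0) ->
    \sum_(k < N + M) a k = \sum_(k < N) a k.
  move=> aN0; rewrite big_split_ord /= [X in _ + X]big1 ?addr0 // => k _.
  by apply: aN0; rewrite leq_addr.
have -> : \sum_(k < n.+2) ((A ^+ k) i j *: binpoly F k).[s%:R] =
    \sum_(k < n.+2) a k.
  by apply: eq_bigr => k _; rewrite hornerZ horner_binpoly mulrC.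
have -> : \sum_(k < s.+1) (A ^+ k *+ 'C(s, k)) i j = \sum_(k < s.+1) a k.
  by apply: eq_bigr => k _; rewrite mulmxnE -mulr_natl.
rewrite -(split_sum n.+2 s.+1) -?(split_sum s.+1 n.+2) 1?addnC // => k lek.
  by rewrite /a bin_small // mul0r.
by rewrite /a Ak0 ?mxE ?mulr0 // ltnW.
Qed.

Lemma powmx_coef0 (F : numFieldType) (n : nat) (A : 'M[F]_n.+1) i j :
  A ^+ n.+1 = 0 -> (powmx A i j)`_0 = (i == j)%:R.
Proof.
by move=> A0; rewrite -horner_coef0 -[0](mulr0n 1) horner_powmx // expr0 mxE.
Qed.

Lemma powmx_coef1 (F : numFieldType) (n : nat) (A : 'M[F]_n.+1) i j :
  (powmx A i j)`_1 = nlog A i j.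
Proof.
rewrite mxE coef_sum summxE; apply: eq_bigr => k _.
by rewrite coefZ mxE mulrC.
Qed.

Lemma polynat_inj (F : numFieldType) (p q : {poly F}) :
  (forall s : nat, p.[s%:R] = q.[s%:R]) -> p = q.
Proof.
move=> pq; apply/eqP; rewrite -subr_eq0; apply/eqP.
pose rs := [seq s%:R : F | s <- iota 0 (size (p - q))].
apply: (@roots_geq_poly_eq0 _ _ rs).
- by apply/allP => _ /mapP[s _ ->]; rewrite rootE hornerD hornerN pq subrr.
- by rewrite map_inj_uniq ?iota_uniq // => a b /eqP; rewrite eqr_nat => /eqP.
- by rewrite size_map size_iota.
Qed.

(** Commuting powers satisfy (1 + C)^s = (1 + A)^s (1 + B)^s for every natural
    number s, hence as an identity of polynomials in s; the coefficients of
    s in it are the logarithms, because all constant coefficients are those of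
    the identity matrix. *)
Lemma nlogD (F : numFieldType) (n : nat) (A B C : 'M[F]_n.+1) :
  A ^+ n.+1 = 0 -> B ^+ n.+1 = 0 -> C ^+ n.+1 = 0 ->
  GRing.comm (1 + A) (1 + B) -> (1 + A) * (1 + B) = 1 + C ->
  nlog C = nlog A + nlog B.
Proof.
move=> A0 B0 C0 cAB defC.
have powM : powmx C = powmx A *m powmx B.
  apply/matrixP => i j; apply: polynat_inj => s.
  rewrite horner_powmx // -defC exprMn_comm // !mxE horner_sum.
  by apply: eq_bigr => l _; rewrite hornerM !horner_powmx.
apply/matrixP => i j; rewrite -powmx_coef1 powM !mxE coef_sum.
under eq_bigr do
  rewrite coefM big_ord_recl big_ord1 /= !powmx_coef0 // !powmx_coef1.
rewrite big_split /= addrC; congr (_ + _).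
  rewrite (bigD1 j) //= eqxx mulr1 big1 ?addr0 // => l /negPf->.
  by rewrite mulr0.
rewrite (bigD1 i) //= eqxx mul1r big1 ?addr0 // => l.
by rewrite eq_sym => /negPf->; rewrite mul0r.
Qed.

Lemma nlog0 (F : numFieldType) (n : nat) : nlog (0 : 'M[F]_n.+1) = 0.
Proof.
rewrite /nlog big1 // => -[[|k] lt_k] _ /=; last by rewrite expr0n scaler0.
by rewrite binpoly0 coefC scale0r.
Qed.

(** * Cyclic vectors of commuting families *)

Lemma spanning_rows (F : fieldType) (m : nat) (S : 'rV[F]_m -> Prop) :
  (forall c : 'cV_m, (forall u, S u -> u *m c = 0) -> c = 0) ->
  exists2 B : 'M[F]_m, B \in unitmx & forall i, S (row i B).
Proof.
move=> Sfull.
have grow k : (k <= m)%N -> exists p (B : 'M[F]_(p, m)),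
    (k <= \rank B)%N /\ forall i, S (row i B).
  elim: k => [|k IHk] lt_km; first by exists 0, 0; split => // -[].
  have [p [B [rankB SB]]] := IHk (ltnW lt_km).
  have [lt_k|] := ltnP k (\rank B); first by exists p, B.
  move=> leB; have {}rankB : \rank B = k by apply/eqP; rewrite eqn_leq leB.
  have [u [Su uB]] : exists u, S u /\ ~~ (u <= B)%MS.
    apply: contrapT => noU.
    have : cokermx B = 0.
      apply/matrixP => i j; rewrite mxE.
      suff /matrixP/(_ i 0) : col j (cokermx B) = 0 by rewrite !mxE.
      apply: Sfull => u Su; have uB : (u <= B)%MS.
        by apply/negPn/negP => uB; apply: noU; exists u.
      by move: uB; rewrite submxE colE mulmxA => /eqP->; rewrite mul0mx.
    move/eqP; rewrite -mxrank_eq0 mxrank_coker rankB subn_eq0.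
    by rewrite leqNgt lt_km.
  exists (p + 1)%N, (col_mx B u); split.
    rewrite -rankB; apply: rank_ltmx; rewrite ltmxE -addsmxE addsmxSl /=.
    by apply: contra uB; apply: submx_trans; rewrite -addsmxE addsmxSr.
  move=> i; case: (split_ordP i) => j ->; first by rewrite rowKu.
  by rewrite rowKd [j]ord1 (_ : row 0 u = u) // row_id.
have [p [B [rankB SB]]] := grow m (leqnn m).
have fullB : row_full B by rewrite -col_leq_rank.
exists (rowsub (fullrankfun fullB) B); first exact: fullrowsub_unit.
by move=> i; rewrite row_rowsub.
Qed.

Inductive lspan {F : fieldType} {m : nat} (H : 'M[F]_m -> Prop) :
    'M[F]_m -> Prop :=
| lspan0 : lspan H 0
| lspanS a Y X : H Y -> lspan H X -> lspan H (a *: Y + X).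

Lemma lspan_sum {F : fieldType} {m : nat} (H : 'M[F]_m -> Prop) (I : finType)
    (a : I -> F) (Y : I -> 'M[F]_m) :
  (forall i, H (Y i)) -> lspan H (\sum_i a i *: Y i).
Proof.
move=> HY; elim/big_rec: _ => [|i X _]; [exact: lspan0 | exact: lspanS].
Qed.

(** No nonzero linear form kills all the X w, so that m of these vectors form a
    basis, and inverting the matrix of that basis provides the E i. A matrix
    that commutes with the family and kills w kills every X w too, so that it
    is zero; hence Z |-> Z w is injective on the commutant, and Z is determined
    by its coordinates on the E i. *)
Lemma dual_basis (F : fieldType) (m : nat) (H : 'M[F]_m -> Prop) (w : 'cV[F]_m) :
  (forall X Y, H X -> H Y -> X *m Y = Y *m X) ->
  (forall c : 'rV_m, (forall Y, H Y -> c *m (Y *m w) = 0) -> c = 0) ->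
  exists E : 'I_m -> 'M[F]_m,
    [/\ forall i, lspan H (E i), forall i, E i *m w = delta_mx i 0
      & forall Z, (forall Y, H Y -> Z *m Y = Y *m Z) ->
          Z = \sum_i (Z *m w) i 0 *: E i].
Proof.
move=> Hcomm Hfull.
have [B Bunit SB] : exists2 B : 'M[F]_m, B \in unitmx &
    forall i, exists2 Y, H Y & row i B = (Y *m w)^T.
  apply: (@spanning_rows F m (fun u => exists2 Y, H Y & u = (Y *m w)^T)).
  move=> c c0; apply: trmx_inj; rewrite trmx0; apply: Hfull => Y HY.
  by apply: trmx_inj; rewrite trmx_mul trmxK trmx0; apply: c0; exists Y.
have {SB} [Y HY] := choice (fun i => let: ex_intro2 Y a b := SB i in
  ex_intro (fun Y => H Y /\ row i B = (Y *m w)^T) Y (conj a b)).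
pose E i := \sum_j invmx B i j *: Y j; exists E.
have spanE i : lspan H (E i) by apply: lspan_sum => j; case: (HY j).
have Ew i : E i *m w = delta_mx i 0.
  apply: trmx_inj; rewrite mulmx_suml linear_sum /=.
  transitivity (row i (invmx B *m B)); last first.
    by rewrite mulVmx // row1 trmx_delta.
  rewrite row_mul mulmx_sum_row; apply: eq_bigr => j _.
  by rewrite -scalemxAl linearZ /= mxE -(HY j).2.
split=> // Z commZ; apply/eqP; rewrite -subr_eq0; apply/eqP.
set X := Z - _.
have spancomm V W : (forall Y, H Y -> V *m Y = Y *m V) -> lspan H W ->
    V *m W = W *m V.
  move=> cV; elim=> [|a V' W' HV' _ IH]; first by rewrite mulmx0 mul0mx.
  by rewrite mulmxDr mulmxDl -scalemxAr -scalemxAl (cV _ HV') IH.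
have commX V : H V -> X *m V = V *m X.
  move=> HV; rewrite mulmxBl mulmxBr commZ //; congr (_ - _).
  rewrite mulmx_suml mulmx_sumr; apply: eq_bigr => i _.
  rewrite -scalemxAl -scalemxAr; congr (_ *: _); apply/esym/spancomm => // W HW.
  exact: Hcomm.
have Xw : X *m w = 0.
  rewrite mulmxBl mulmx_suml; apply/eqP; rewrite subr_eq0; apply/eqP.
  move: (Z *m w) => z; apply/matrixP => i j; rewrite [j]ord1 summxE.
  under eq_bigr do rewrite -scalemxAl Ew !mxE eqxx andbT.
  rewrite (bigD1 i) //= eqxx mulr1 big1 ?addr0 // => l.
  by rewrite eq_sym => /negPf->; rewrite mulr0.
have XE i : X *m delta_mx i 0 = 0 :> 'cV_m.
  by rewrite -Ew mulmxA spancomm // -mulmxA Xw mulmx0.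
by apply/matrixP => i j; have /matrixP/(_ i 0) := XE j; rewrite -colE !mxE.
Qed.

(** * Block diagonal lower triangular matrices with constant diagonals *)

(** The block decomposition is encoded by the map from indices to blocks, so
    that the membership condition is a family of linear equations on entries
    and no size has to be transported. *)
Definition block_ltrig {F : fieldType} {m r : nat} (blk : 'I_m -> 'I_r)
    (X : 'M[F]_m) : Prop :=
  (forall i j, X i j != 0 -> blk i = blk j /\ (j <= i)%N) /\
  (forall i j, blk i = blk j -> X i i = X j j).

Section BlockTriangular.
Context {F : fieldType} {m r : nat} (blk : 'I_m -> 'I_r).
Implicit Types X Y : 'M[F]_m.

Lemma block_ltrig0 X i j : block_ltrig blk X ->
  ~ (blk i = blk j /\ (j <= i)%N) -> X i j = 0.
Proof. by move=> [Xlt _] nij; apply/eqP/negPn/negP => /Xlt. Qed.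

Lemma block_ltrig_lin a X Y :
  block_ltrig blk X -> block_ltrig blk Y -> block_ltrig blk (a *: X + Y).
Proof.
move=> Xb Yb; split=> [i j|i j eq_ij]; last first.
  by rewrite !mxE (Xb.2 i j) // (Yb.2 i j).
rewrite !mxE; have [->|/Yb.1 //] := eqVneq (Y i j) 0.
have [->|/Xb.1 //] := eqVneq (X i j) 0.
by rewrite mulr0 addr0 eqxx.
Qed.

Lemma block_ltrig_span (H : 'M[F]_m -> Prop) X :
  (forall Y, H Y -> block_ltrig blk Y) -> lspan H X -> block_ltrig blk X.
Proof.
move=> Hb; elim=> [|a Y Z /Hb Yb _ Zb]; last exact: block_ltrig_lin.
by split=> i j; rewrite !mxE ?eqxx.
Qed.

Definition block_scalar (mu : 'I_r -> F) : 'M[F]_m :=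
  \matrix_(i, j) (mu (blk i) *+ (i == j)).

Lemma block_scalar_ltrig mu : block_ltrig blk (block_scalar mu).
Proof.
split=> i j; rewrite !mxE; last by rewrite !eqxx => ->.
by have [->|_] := eqVneq i j; rewrite ?eqxx.
Qed.

Lemma block_scalarC mu X :
  block_ltrig blk X -> block_scalar mu *m X = X *m block_scalar mu.
Proof.
move=> Xb; apply/matrixP => i j; rewrite !mxE.
rewrite [LHS](bigD1 i) //= [RHS](bigD1 j) //= !mxE !eqxx !mulr1n.
rewrite !big1 ?addr0.
- rewrite mulrC; have [->|/Xb.1[-> _] //] := eqVneq (X i j) 0.
  by rewrite !mul0r.
- by move=> l /negPf nlj; rewrite mxE nlj mulr0.
- by move=> l; rewrite eq_sym mxE => /negPf->; rewrite mul0r.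
Qed.

Lemma block_ltrig_mul_diag X Y i : block_ltrig blk X -> block_ltrig blk Y ->
  (X *m Y) i i = X i i * Y i i.
Proof.
move=> Xb Yb; rewrite mxE (bigD1 i) //= big1 ?addr0 // => l nli.
apply/eqP/negPn; rewrite mulf_eq0 negb_or; apply/negP.
move=> /andP[/Xb.1[_ le_li] /Yb.1[_ le_il]].
by case/eqP: nli; apply/val_inj/anti_leq; rewrite le_li.
Qed.

(** With D the diagonal of X, this is D^-1 X - 1, the strictly lower triangular
    part U of X = D (1 + U). *)
Definition upart X : 'M[F]_m := \matrix_(i, j) (X i j / X i i - (i == j)%:R).

Lemma upart_lt X i j : block_ltrig blk X -> (forall i, X i i != 0) ->
  upart X i j != 0 -> (j < i)%N.
Proof.
move=> Xb Xd; rewrite mxE; have [<-|nij] := eqVneq i j.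
  by rewrite divff // subrr eqxx.
rewrite subr0 ltn_neqAle val_eqE (eq_sym j) nij /= mulf_eq0 negb_or.
by case/andP => /Xb.1[].
Qed.

End BlockTriangular.

Lemma block_ltrig_diag_neq0 (F : fieldType) (m r : nat) (blk : 'I_m -> 'I_r)
    (X : 'M[F]_m) i : block_ltrig blk X -> X \in unitmx -> X i i != 0.
Proof.
move=> Xb; rewrite unitmxE det_trig; last first.
  apply/is_trig_mxP => k l lt_kl; apply: (block_ltrig0 Xb).
  by case=> _; rewrite leqNgt lt_kl.
by rewrite unitfE prodf_seq_neq0 => /allP/(_ i (mem_index_enum _)).
Qed.

Lemma block_ltrig_row0 (F : fieldType) (n r : nat) (blk : 'I_n.+1 -> 'I_r)
    (X : 'M[F]_n.+1) (u : 'cV[F]_n.+1) :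
  block_ltrig blk X -> X ord0 ord0 = 1 -> (X *m u) ord0 0 = u ord0 0.
Proof.
move=> Xb X00; rewrite mxE (bigD1 ord0) //= X00 mul1r big1 ?addr0 // => j nj.
suff -> : X ord0 j = 0 by rewrite mul0r.
apply: (block_ltrig0 Xb) => -[_]; rewrite leqn0 => /eqP j0.
by case/eqP: nj; apply: val_inj.
Qed.

Lemma strict_ltrig_nilp {F : fieldType} {n : nat} (A : 'M[F]_n.+1) :
  (forall i j, A i j != 0 -> (j < i)%N) -> A ^+ n.+1 = 0.
Proof.
move=> Alt; have Ak k i j : (A ^+ k) i j != 0 -> (j + k <= i)%N.
  elim: k i j => [|k IHk] i j.
    rewrite expr0 mxE addn0; have [->//|_] := eqVneq i j.
    by rewrite eqxx.
  rewrite exprS mxE => Aij.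
  have [l] : exists l, A i l * (A ^+ k) l j != 0.
    apply/existsP; apply: contraNT Aij; rewrite negb_exists => /forallP z.
    by rewrite big1 // => l _; apply/eqP/negPn.
  rewrite mulf_eq0 negb_or => /andP[/Alt lt_li /IHk le_jl].
  by rewrite addnS (leq_ltn_trans le_jl).
apply/matrixP => i j; rewrite [RHS]mxE; apply/eqP/negPn/negP => /Ak.
by rewrite addnS leqNgt ltnS (leq_trans (leq_ord i)) // leq_addl.
Qed.

Section BlockTriangularLog.
Context {F : numFieldType} {n r : nat} (blk : 'I_n.+1 -> 'I_r).
Implicit Types X Y : 'M[F]_n.+1.

(** D commutes with the whole of the algebra because it is scalar on each
    block, so that it can be moved across the product. *)
Lemma upartM X Y : block_ltrig blk X -> block_ltrig blk Y ->
  (1 + upart X) * (1 + upart Y) = 1 + upart (X *m Y).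
Proof.
move=> Xb Yb.
have E (Z : 'M[F]_n.+1) : 1 + upart Z = \matrix_(i, j) (Z i j / Z i i).
  by apply/matrixP => i j; rewrite !mxE addrC subrK.
rewrite !E; apply/matrixP => i j.
rewrite [RHS]mxE (block_ltrig_mul_diag _ Xb Yb) !mxE mulr_suml.
apply: eq_bigr => l _; rewrite !mxE.
have [->|/Xb.1[eqb _]] := eqVneq (X i l) 0; first by rewrite !mul0r.
by rewrite (Yb.2 l i) // invfM mulrACA.
Qed.

Lemma nlog_upartM X Y : block_ltrig blk X -> block_ltrig blk Y ->
  (forall i, X i i != 0) -> (forall i, Y i i != 0) -> X *m Y = Y *m X ->
  nlog (upart (X *m Y)) = nlog (upart X) + nlog (upart Y).
Proof.
move=> Xb Yb Xd Yd cXY; have XYM := upartM Xb Yb.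
apply: nlogD => //; last first.
- by rewrite /GRing.comm XYM cXY upartM.
- apply: strict_ltrig_nilp => i j.
  rewrite mxE; have [<-|nij] := eqVneq i j.
    by rewrite divff ?subrr ?eqxx // (block_ltrig_mul_diag _ Xb Yb) mulf_neq0.
  rewrite subr0 ltn_neqAle val_eqE (eq_sym j) nij /= mulf_eq0 negb_or.
  case/andP; rewrite mxE => XYij _.
  have [l] : exists l, X i l * Y l j != 0.
    apply/existsP; apply: contraNT XYij; rewrite negb_exists => /forallP z.
    by rewrite big1 // => l _; apply/eqP/negPn.
  rewrite mulf_eq0 negb_or => /andP[/Xb.1[_ le_li] /Yb.1[_ le_jl]].
  exact: leq_trans le_jl le_li.
- by apply: strict_ltrig_nilp => i j; apply: (upart_lt Yb Yd).
- by apply: strict_ltrig_nilp => i j; apply: (upart_lt Xb Xd).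
Qed.

End BlockTriangularLog.

(** * The additive coordinates *)

Section LogIndex.
Context {n r : nat}.
Variable blk : 'I_n.+1 -> 'I_r.

Definition block_head (j : 'I_n.+1) : bool :=
  [forall i, (blk i == blk j) ==> (j <= i)%N].

Lemma block_headP j :
  reflect (forall i, blk i = blk j -> (j <= i)%N) (block_head j).
Proof.
apply: (iffP forallP) => [fj i eq_b|fj i]; last by apply/implyP => /eqP/fj.
by have /implyP := fj i; apply; rewrite eq_b.
Qed.

Lemma block_head0 : block_head ord0.
Proof. exact/block_headP. Qed.

Lemma block_head_inj i j : block_head i -> block_head j -> blk i = blk j -> i = j.
Proof.
move=> /block_headP fi /block_headP fj eq_b; apply/val_inj/anti_leq.
by rewrite fi // fj.
Qed.

Lemma block_head_ex i : exists2 f, block_head f & blk f = blk i.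
Proof.
have := @arg_minnP _ i (fun j => blk j == blk i) (fun j => val j) (eqxx _).
case=> f /eqP eq_b fmin; exists f => //; apply/block_headP => j.
by rewrite eq_b => /eqP/fmin.
Qed.

(** Indices of the additive coordinates: (f, false) for the logarithm of a
    modulus at a first index f, and (j, false), (j, true) for the real and
    imaginary parts of a coordinate j of the nilpotent logarithm. The index 0
    is left out because the diagonal entry there is 1 on the orbit. *)
Definition log_index : {set 'I_n.+1 * bool} :=
  [set p | if block_head p.1 then ~~ p.2 && (p.1 != ord0) else true].

Lemma card_log_index : (forall k, exists i, blk i = k) ->
  (#|log_index| + r.+1 = 2 * n.+1)%N.
Proof.
move=> blk_surj.
have card_first : #|[set j | block_head j]| = r.
  rewrite -[RHS]card_ord -(card_in_imset (f := blk)).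
    rewrite -cardsT; congr #|pred_of_set _|; apply/setP => k; rewrite [RHS]inE.
    apply/imsetP; have [i <-] := blk_surj k.
    by have [f ff <-] := block_head_ex i; exists f; rewrite ?inE.
  by move=> i j; rewrite !inE; apply: block_head_inj.
have -> : r.+1 = #|~: log_index|.
  have -> : ~: log_index =
      (ord0, false) |: finset.setX [set j | block_head j] [set true].
    apply/setP => -[j b]; rewrite !inE /= xpair_eqE.
    by case: b; case: eqVneq => [->|_]; rewrite ?block_head0 //; case: (block_head j).
  by rewrite cardsU1 cardsX cards1 muln1 card_first !inE /= andbF.
by rewrite cardsC card_prod card_ord card_bool mulnC.
Qed.

End LogIndex.

Section LeadingLog.
Context {F : numFieldType} {n : nat}.
Implicit Types (A : 'M[F]_n.+1) (v : 'cV[F]_n.+1).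

Lemma strict_ltrig_expS A v (j : nat) (k : nat) (s : 'I_n.+1) :
  (forall i l, A i l != 0 -> (l < i)%N) ->
  (forall l : 'I_n.+1, (l < j)%N -> v l 0 = 0) -> (s <= j)%N ->
  (A ^+ k.+1 *m v) s 0 = 0.
Proof.
move=> Alt; elim: k v s => [|k IHk] v s vj le_sj; last first.
  rewrite exprSr -mulmxA; apply: IHk => // l lt_lj.
  rewrite mxE big1 // => i _.
  have [->|/Alt lt_il] := eqVneq (A l i) 0; first by rewrite mul0r.
  by rewrite vj ?mulr0 // (ltn_trans lt_il).
rewrite expr1 mxE big1 // => i _.
have [->|/Alt lt_is] := eqVneq (A s i) 0; first by rewrite mul0r.
by rewrite vj ?mulr0 // (leq_trans lt_is).
Qed.

(** Every application of A pushes the support of a vector down by at least one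
    index, so that the terms A^k with k >= 2 do not reach the index j where
    A v starts. *)
Lemma nlog_leading A v (j : nat) (s : 'I_n.+1) :
  (forall i l, A i l != 0 -> (l < i)%N) ->
  (forall l : 'I_n.+1, (l < j)%N -> (A *m v) l 0 = 0) -> (s <= j)%N ->
  (nlog A *m v) s 0 = (A *m v) s 0.
Proof.
move=> Alt vj le_sj; rewrite /nlog big_ord_recl big_ord_recl /=.
rewrite binpoly0 binpoly1 coefC scale0r add0r coefX scale1r expr1.
rewrite mulmxDl [LHS]mxE mulmx_suml summxE big1 ?addr0 // => k _.
rewrite -scalemxAl mxE /bump /= !add1n.
by rewrite exprSr -mulmxA (strict_ltrig_expS (j := j)) ?mulr0.
Qed.

End LeadingLog.

Section LogCoordinates.
Context {R : realType} {n r : nat} (blk : 'I_n.+1 -> 'I_r) (w : 'cV[R[i]]_n.+1).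
Implicit Types (X Y : 'M[R[i]]_n.+1).

Definition log_coord X (p : 'I_n.+1 * bool) : R :=
  if block_head blk p.1 then ln (complex.Re `|X p.1 p.1|)
  else let z := (nlog (upart X) *m w) p.1 0 in
    if p.2 then complex.Im z else complex.Re z.

Lemma log_coordM X Y p : block_ltrig blk X -> block_ltrig blk Y ->
  (forall i, X i i != 0) -> (forall i, Y i i != 0) -> X *m Y = Y *m X ->
  log_coord (X *m Y) p = log_coord X p + log_coord Y p.
Proof.
move=> Xb Yb Xd Yd cXY; rewrite /log_coord (nlog_upartM Xb Yb Xd Yd cXY).
rewrite (block_ltrig_mul_diag _ Xb Yb) mulmxDl.
have normc_gt0 (z : R[i]) : z != 0 -> 0 < complex.Re `|z|.
  by rewrite -normr_gt0 ltcE => /andP[].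
case: ifP => _; last by rewrite mxE; case: p.2; rewrite raddfD.
rewrite normrM -lnM ?posrE ?normc_gt0 //; congr ln.
by rewrite normc_def; simpc.
Qed.

End LogCoordinates.

Section Witness.
Context {R : realType} {n r : nat}.
Variables (blk : 'I_n.+1 -> 'I_r) (w : 'cV[R[i]]_n.+1).
Variables (H : 'M[R[i]]_n.+1 -> Prop) (E : 'I_n.+1 -> 'M[R[i]]_n.+1).
Hypothesis Hb : forall Y, H Y -> block_ltrig blk Y.
Hypothesis Eb : forall i, block_ltrig blk (E i).
Hypothesis EH : forall i Y, H Y -> E i *m Y = Y *m E i.
Hypothesis Ew : forall i, E i *m w = delta_mx i 0.

(** The witness X = 1 + t (E j) is unipotent: E j w is the j-th basis vector,
    which vanishes at the first index of every block, j not being one of them,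
    whereas w does not; so the diagonal of E j is zero. The higher powers of
    E j in the logarithm of X only affect the coordinates after j. *)
Lemma log_coord_unipotent j (t : R[i]) : ~~ block_head blk j ->
  exists X, [/\ forall Y, H Y -> X *m Y = Y *m X, block_ltrig blk X,
    forall i, X i i = 1 &
    forall (l : 'I_n.+1) (b : bool), (l <= j)%N || block_head blk l ->
      log_coord blk w X (l, b) =
        if l == j then (if b then complex.Im t else complex.Re t) else 0].
Proof.
move=> nfj; pose N := t *: E j.
have Nb : block_ltrig blk N.
  rewrite -[N]addr0; apply: block_ltrig_lin => //.
  by split=> i l; rewrite !mxE ?eqxx.
(* A row at the first index of a block has only its diagonal entry. *)
have row_first (Z : 'M[R[i]]_n.+1) f : block_ltrig blk Z -> block_head blk f ->
    (Z *m w) f 0 = Z f f * w f 0.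
  move=> Zb /block_headP ff; rewrite mxE (bigD1 f) //= big1 ?addr0 // => l nlf.
  have [->|/Zb.1[eq_b le_lf]] := eqVneq (Z f l) 0; first by rewrite mul0r.
  by case/eqP: nlf; apply/val_inj/anti_leq; rewrite le_lf ff.
have Nw : N *m w = t *: delta_mx j 0 by rewrite -scalemxAl Ew.
have Nd i : N i i = 0.
  have [f ff eq_b] := block_head_ex blk i; rewrite -(Nb.2 f i eq_b).
  have := row_first _ _ (Eb f) ff; rewrite Ew mxE !eqxx => /esym wf.
  have wf_neq0 : w f 0 != 0.
    by apply/eqP => w0; move/eqP: wf; rewrite w0 mulr0 eq_sym oner_eq0.
  apply: (mulIf wf_neq0); rewrite mul0r -row_first // Nw !mxE.
  have /negPf-> : f != j by apply: contraNneq nfj => <-.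
  by rewrite mulr0.
have Nlt i l : N i l != 0 -> (l < i)%N.
  move=> nz; rewrite ltn_neqAle (Nb.1 i l nz).2 andbT.
  by apply: contraNneq nz => /ord_inj eq_li; rewrite eq_li Nd.
have Xd i : (1 + N) i i = 1.
  by move: (Nd i); rewrite !mxE eqxx => ->; rewrite addr0.
have XN : upart (1 + N) = N.
  by apply/matrixP => i l; rewrite mxE Xd divr1 !mxE addrAC subrr add0r.
exists (1 + N); split => //.
- by move=> Y HY; rewrite mulmxDl mulmxDr mul1mx mulmx1 -scalemxAl -scalemxAr EH.
- rewrite -[X in X + _](scale1r (1 : 'M[R[i]]_n.+1)); apply: block_ltrig_lin => //.
  split=> i l; rewrite !mxE ?eqxx //.
  by have [->|_] := eqVneq i l; rewrite ?eqxx.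
move=> l b; rewrite /log_coord Xd normr1 [complex.Re _]/= ln1 XN /=.
have [fl _|_] := ifP; first by case: eqP => // eq_lj; rewrite -eq_lj fl in nfj.
rewrite orbF => le_lj; rewrite (nlog_leading (j := j)) //.
- rewrite Nw !mxE eqxx andbT; case: eqVneq => _; first by rewrite mulr1.
  by rewrite mulr0; case: b.
- move=> i lt_ij; rewrite Nw !mxE; case: eqVneq => [eq_ij|_]; last by rewrite mulr0.
  by rewrite eq_ij ltnn in lt_ij.
Qed.

Lemma log_coord_semisimple j (t : R) : block_head blk j ->
  exists X, [/\ forall Y, H Y -> X *m Y = Y *m X, block_ltrig blk X,
    forall i, X i i != 0, (j != ord0 -> X ord0 ord0 = 1) &
    forall (l : 'I_n.+1) (b : bool),
      log_coord blk w X (l, b) = if l == j then t else 0].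
Proof.
move=> fj; pose mu k := if k == blk j then (expR t)%:C else 1 : R[i].
have exp_neq0 : (expR t)%:C != 0 :> R[i].
  by apply/eqP => -[/eqP]; rewrite gt_eqF ?expR_gt0.
exists (block_scalar blk mu); have Xb := block_scalar_ltrig blk mu.
split=> //.
- by move=> Y /Hb; apply: block_scalarC.
- by move=> i; rewrite mxE eqxx /mu; case: ifP => // _; rewrite oner_eq0.
- move=> nj0; rewrite mxE eqxx /mu; case: eqP => // eq_b; case/eqP: nj0.
  by apply: (block_head_inj fj (block_head0 blk)).
move=> l b; rewrite /log_coord /=.
have -> : upart (block_scalar blk mu) = 0.
  apply/matrixP => i k; rewrite !mxE eqxx; have [->|_] := eqVneq i k.
    by rewrite divff ?subrr // /mu; case: ifP => // _; rewrite oner_eq0.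
  by rewrite mul0r subr0.
rewrite nlog0 mul0mx !mxE eqxx /mu; have [fl|nfl] := ifP.
  have [->|nlj] := eqVneq l j.
    by rewrite eqxx /= expr0n addr0 sqrtr_sqr ger0_norm ?expR_ge0 // expRK.
  case: eqP => [/(block_head_inj fl fj)/eqP|_]; first by rewrite (negPf nlj).
  by rewrite Normc.normc1 ln1.
by case: eqP => [eq_lj|_]; [rewrite eq_lj fj in nfl | case: b].
Qed.

(** If some nilpotent coordinate has a nonzero coefficient, the last such index
    j gives a combination whose value at 1 + t (E j) is linear in t; otherwise
    only moduli are involved, and one of them can be scaled freely. *)
Lemma log_coord_half (x : 'I_n.+1 * bool -> R) p0 :
  p0 \in log_index blk -> x p0 != 0 ->
  exists X, [/\ forall Y, H Y -> X *m Y = Y *m X, block_ltrig blk X,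
    forall i, X i i != 0, X ord0 ord0 = 1 &
    \sum_(p in log_index blk) x p * log_coord blk w X p = 2^-1].
Proof.
move=> p0T xp0.
pose P (j : 'I_n.+1) :=
  ~~ block_head blk j && ((x (j, false) != 0) || (x (j, true) != 0)).
have [[j0 Pj0]|noP] := pselect (exists j, P j).
  have := @arg_maxnP _ j0 P (fun j => val j) Pj0.
  case=> j /andP[nfj xj] jmax.
  pose a := x (j, false); pose b := x (j, true).
  have ab_neq0 : a ^+ 2 + b ^+ 2 != 0.
    rewrite paddr_eq0 ?sqr_ge0 // !expf_eq0 /= negb_and //.
  (* This t solves a Re t + b Im t = 1/2. *)
  pose d := 2 * (a ^+ 2 + b ^+ 2); pose t : R[i] := Complex (a / d) (b / d).
  have [X [XH Xb Xd Xlog]] := log_coord_unipotent t nfj.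
  exists X; split=> //; first by move=> i; rewrite Xd oner_eq0.
  rewrite (bigD1 (j, false)) /=; last by rewrite inE /= (negPf nfj).
  rewrite (bigD1 (j, true)) /=; last by rewrite inE /= (negPf nfj) xpair_eqE andbF.
  rewrite !Xlog ?leqnn ?eqxx //= big1; last first.
    case=> l c /andP[/andP[_ nl1] nl2].
    have nlj : l != j.
      apply: contraNneq nl1 => eq_lj; move: nl2; rewrite eq_lj.
      by case: c; rewrite eqxx.
    have [le_lj|] := boolP ((l <= j)%N || block_head blk l).
      by rewrite Xlog // (negPf nlj) mulr0.
    rewrite negb_or -ltnNge => /andP[lt_jl nfl].
    suff -> : x (l, c) = 0 by rewrite mul0r.
    apply/eqP; apply: contraNT nlj => xlc; apply/eqP/val_inj/anti_leq.
    rewrite (ltnW lt_jl) andbT; apply: jmax; rewrite /P nfl /=.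
    by case: c xlc {nl1 nl2} => ->; rewrite ?orbT.
  by rewrite -/a -/b addr0 /d; field.
have x0 l c : ~~ block_head blk l -> x (l, c) = 0.
  move=> nfl; apply/eqP/negPn/negP => xlc; apply: noP; exists l.
  by rewrite /P nfl; case: c xlc => ->; rewrite ?orbT.
case: p0 p0T xp0 => j b0; rewrite inE /=.
have [fj|/negbT nfj _] := ifP; last by rewrite x0 ?eqxx.
case/andP => /negPf-> nj0 xj.
have [X [XH Xb Xd X0 Xlog]] := log_coord_semisimple ((x (j, false))^-1 / 2) fj.
exists X; split=> //; first exact: X0.
rewrite (bigD1 (j, false)) /=; last by rewrite inE /= fj.
rewrite Xlog eqxx mulrA divff // mul1r big1 ?addr0 // => -[l c] /andP[].
rewrite inE Xlog /=; case: (eqVneq l j) => [->|_ _ _]; last by rewrite mulr0.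
by rewrite fj => /andP[/negPf-> _]; rewrite eqxx.
Qed.
End Witness.

(** If the square matrix of the values is singular, a nonzero form vanishes on
    all the vectors; otherwise a form takes the value 1 on each of them. *)
Lemma integral_functional (R : realType) (q : nat) (T : finType) (S : {set T})
    (a : 'I_q -> T -> R) : #|S| = q -> (0 < q)%N ->
  exists x : T -> R, (exists2 p, p \in S & x p != 0) /\
    forall i, \sum_(p in S) x p * a i p \is a Num.int.
Proof.
move=> cardS q_gt0; subst q.
pose A := \matrix_(s < #|S|, i < #|S|) a i (enum_val s).
suff [u u_neq0 uA] : exists2 u : 'rV_#|S|, u != 0 &
    forall i, (u *m A) 0 i \is a Num.int.
  have [p0 p0S] : exists p0, p0 \in S by apply/card_gt0P.
  exists (fun p => u 0 (enum_rank_in p0S p)); split.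
    have /rV0Pn[s us] := u_neq0; exists (enum_val s); first exact: enum_valP.
    by rewrite enum_valK_in.
  move=> i; rewrite (reindex_omap enum_val (fun p => Some (enum_rank_in p0S p))).
    rewrite big_mkcond /=; have := uA i; rewrite mxE.
    set v := (X in X \is a _ -> _); set v' := (X in _ -> X \is a _).
    suff -> : v' = v by []. 
    by apply: eq_bigr => s _; rewrite mxE enum_valP enum_valK_in eqxx.
  by move=> p pS /=; rewrite enum_rankK_in.
have [Aunit|] := boolP (A \in unitmx).
  exists (const_mx 1 *m invmx A).
    apply/eqP => /(congr1 (mulmx^~ A)); rewrite mulmxKV // mul0mx => /matrixP.
    by move=> /(_ 0 (Ordinal q_gt0)) /eqP; rewrite !mxE oner_eq0.
  by move=> i; rewrite mulmxKV // mxE.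
rewrite -row_free_unit -kermx_eq0 => /rowV0Pn[u /sub_kermxP uA u_neq0].
by exists u => // i; rewrite uA mxE.
Qed.

Local Open Scope classical_set_scope.
Local Open Scope ring_scope.
Local Open Scope complex_scope.

(** * Continuity and density *)

Section Continuity.
Context {R : realType} {T : topologicalType} (z0 : T).
Implicit Types f g : T -> R[i].

Lemma eq_continuous_at (U : topologicalType) (f g : T -> U) : f =1 g ->
  {for z0, continuous g} -> {for z0, continuous f}.
Proof. by move=> /funext->. Qed.

Lemma continuous_at_sum (I : finType) (P : pred I) (f : I -> T -> R[i]) :
  (forall i, P i -> {for z0, continuous (f i)}) ->
  {for z0, continuous (fun z => \sum_(i | P i) f i z)}.
Proof.
by move=> fc; apply: cvg_big => //; apply: (@add_continuous R[i]^o).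
Qed.

Definition continuous_mx_at (m p : nat) (X : T -> 'M[R[i]]_(m, p)) : Prop :=
  forall i j, {for z0, continuous (fun z => X z i j)}.

Lemma continuous_mx_mul (m p q : nat) (X : T -> 'M[R[i]]_(m, p)) Y :
  continuous_mx_at X -> continuous_mx_at Y ->
  continuous_mx_at (fun z => X z *m Y z : 'M[R[i]]_(m, q)).
Proof.
move=> cX cY i j; apply: eq_continuous_at (fun z => mxE _ _ _ _) _.
apply: continuous_at_sum => l _; exact: (cvgM (cX i l) (cY l j)).
Qed.

Lemma continuous_mx_cst (m p : nat) (A : 'M[R[i]]_(m, p)) :
  continuous_mx_at (fun=> A).
Proof. by move=> i j; apply: cvg_cst. Qed.

Lemma continuous_mx_nlog (n : nat) (X : T -> 'M[R[i]]_n.+1) :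
  continuous_mx_at X -> continuous_mx_at (fun z => nlog (X z)).
Proof.
move=> cX i j; apply: eq_continuous_at (fun z => summxE _ _ _ _ _) _.
apply: continuous_at_sum => k _; apply: eq_continuous_at (fun z => mxE _ _ _ _) _.
apply: cvgM; first exact: cvg_cst.
elim: (k : nat) i j => [|l IHl] i j; first exact: continuous_mx_cst.
apply: (eq_continuous_at (g := fun z => (X z *m X z ^+ l) i j)).
  by move=> z; rewrite exprS.
exact: continuous_mx_mul.
Qed.

Lemma continuous_mx_upart (m : nat) (X : T -> 'M[R[i]]_m) :
  (forall i, X z0 i i != 0) ->
  continuous_mx_at X -> continuous_mx_at (fun z => upart (X z)).
Proof.
move=> Xd cX i j; apply: eq_continuous_at (fun z => mxE _ _ _ _) _.
have cdiv : {for z0, continuous (fun z => X z i j / X z i i)}.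
  exact: (cvgM (cX i j) (cvgV (Xd i) (cX i i))).
have ccst : {for z0, continuous (fun=> (i == j)%:R : R[i])} by apply: cvg_cst.
exact: (@cvgB R[i] R[i]^o _ _ _ _ _ _ _ cdiv ccst).
Qed.

Lemma continuous_Re_Im (b : bool) f : {for z0, continuous f} ->
  {for z0, continuous (fun z =>
     if b then complex.Im (f z) else complex.Re (f z))}.
Proof.
move=> fc; apply/cvgrPdist_lt => e e0.
have e0' : 0 < e%:C :> R[i] by rewrite ltcR.
have fe := (@cvgrPdist_lt R[i] R[i]^o T (nbhs z0) _ f (f z0)).1 fc _ e0'.
near=> z.
have : `|f z0 - f z| < e%:C by near: z; exact: fe.
rewrite -ltcR; apply: le_lt_trans.
have ge_Im (u : R[i]) : `|complex.Im u|%:C <= `|u|.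
  by rewrite normc_def lecR -sqrtr_sqr ler_wsqrtr // lerDr sqr_ge0.
case: b.
  by rewrite -raddfB; exact: ge_Im.
by rewrite -raddfB; exact: normc_ge_Re.
Unshelve. all: by end_near. Qed.

Lemma continuous_log_coord (n r : nat) (blk : 'I_n.+1 -> 'I_r)
    (w : 'cV[R[i]]_n.+1) (X : T -> 'M[R[i]]_n.+1) p :
  (forall i, X z0 i i != 0) -> continuous_mx_at X ->
  {for z0, continuous (fun z => log_coord blk w (X z) p)}.
Proof.
move=> Xd cX; rewrite /log_coord; case: (block_head blk p.1); last first.
  have clog : {for z0, continuous (fun z => (nlog (upart (X z)) *m w) p.1 0)}.
    apply: continuous_mx_mul; last exact: continuous_mx_cst.
    exact/continuous_mx_nlog/continuous_mx_upart.
  exact: (@continuous_Re_Im p.2 _ clog).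
have cnorm : {for z0, continuous (fun z => `|X z p.1 p.1|)}.
  have cXp : {for z0, continuous (fun z => X z p.1 p.1)} := cX p.1 p.1.
  exact: (@cvg_norm R[i] R[i]^o _ _ _ _ _ cXp).
have c1 := @continuous_Re_Im false _ cnorm.
have pos : 0 < complex.Re `|X z0 p.1 p.1|.
  by have := Xd p.1; rewrite -normr_gt0 ltcE => /andP[].
exact: (continuous_comp c1 (continuous_ln pos)).
Qed.

End Continuity.

Lemma dense_continuous_at (T U : topologicalType) (S : set T) (f : T -> U) z0
    (V : set U) : dense S -> {for z0, continuous f} -> nbhs (f z0) V ->
  exists2 s, S s & V (f s).
Proof.
move=> Sd fc /fc; rewrite /= nbhsE; case=> O [Oop Oz0] OV.
have [s [Os Ss]] := Sd O (ex_intro _ z0 Oz0) Oop.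
by exists s => //; apply: OV.
Qed.

Lemma continuous_col_mx1 (R : realType) (n : nat) (z0 : 'cV[R[i]]_n) :
  continuous_mx_at z0 (fun z => col_mx 1%:M z : 'cV[R[i]]_(1 + n)).
Proof.
move=> i j; apply: eq_continuous_at (fun z => mxE _ _ _ _) _.
case: splitP => k _; first exact: (@continuous_mx_cst _ _ _ _ _ 1%:M k j).
exact: coord_continuous.
Qed.

Lemma dense_affine_functional (R : realType) (n : nat) (S : set 'cV[R[i]]_n)
    (c : 'rV[R[i]]_(1 + n)) : dense S ->
  (forall s, S s -> c *m col_mx 1%:M s = 0) -> c = 0.
Proof.
move=> Sd cS.
have call (z : 'cV[R[i]]_n) : c *m col_mx 1%:M z = 0.
  pose f (z : 'cV[R[i]]_n) := (c *m col_mx 1%:M z) 0 0.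
  suff f0 : f z = 0 by apply/matrixP => i j; rewrite !ord1 [RHS]mxE.
  apply: contrapT => /eqP fz.
  have fc : {for z, continuous f}.
    apply: continuous_mx_mul; first exact: continuous_mx_cst.
    exact: continuous_col_mx1.
  have nz : nbhs (f z) [set y | y != 0 :> R[i]].
    by apply: (@cvgr_neq0 R[i] R[i]^o _ (nbhs (f z)) _ id (f z)) => //; apply: cvg_id.
  have [s Ss] := dense_continuous_at Sd fc nz.
  by rewrite /f /= (cS s Ss) mxE eqxx.
rewrite -[c]hsubmxK; have c0 := call 0.
rewrite -[c in c *m _]hsubmxK mul_row_col mulmx1 mulmx0 addr0 in c0.
rewrite c0; suff -> : rsubmx c = 0 by rewrite row_mx0.
apply/matrixP => i j; have := call (delta_mx j 0).
rewrite -[c in c *m _]hsubmxK mul_row_col mulmx1 c0 add0r -colE => /matrixP.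
by move=> /(_ i 0); rewrite !mxE.
Qed.

(** * The obstruction *)

(** The map y stands for an affine chart of the hyperplane of the vectors with
    the first coordinate of w, and the condition on the sets K expresses by
    induction that the g i generate the semigroup H. *)
Lemma no_dense_commuting_orbit (R : realType) (n r q : nat)
    (blk : 'I_n.+1 -> 'I_r) (H : set 'M[R[i]]_n.+1) (w : 'cV[R[i]]_n.+1)
    (g : 'I_q -> 'M[R[i]]_n.+1)
    (T : topologicalType) (S : set T) (y : T -> 'cV[R[i]]_n.+1) :
  (forall k, exists i, blk i = k) -> (q + r.+1 = 2 * n.+1)%N -> (0 < q)%N ->
  (forall X, H X -> block_ltrig blk X) ->
  (forall X Y, H X -> H Y -> X *m Y = Y *m X) ->
  (forall i, g i \in unitmx) -> (forall i, H (g i)) ->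
  (forall K : set 'M[R[i]]_n.+1, (forall i, K (g i)) ->
     (forall X Y, H X -> H Y -> K X -> K Y -> K (X *m Y)) -> H `<=` K) ->
  (forall c : 'rV_n.+1, (forall X, H X -> c *m (X *m w) = 0) -> c = 0) ->
  (forall z, continuous_mx_at z y) ->
  (forall u : 'cV[R[i]]_n.+1, u ord0 0 = w ord0 0 -> exists z, y z = u) ->
  (forall s, S s -> exists2 X, H X & y s = X *m w) ->
  ~ dense S.
Proof.
move=> blk_surj qr q_gt0 Hb Hcomm g_unit Hg Hind Hfull y_cont y_surj yS S_dense.
have [E [Espan Ew Ecoord]] := dual_basis Hcomm Hfull.
have Eb i : block_ltrig blk (E i) by apply: (block_ltrig_span Hb).
have EH i Y : H Y -> E i *m Y = Y *m E i.
  move=> HY; elim: (Espan i) => [|a X Z HX _ IH]; first by rewrite mulmx0 mul0mx.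
  by rewrite mulmxDl mulmxDr -scalemxAl -scalemxAr IH (Hcomm X Y).
have [x [[p0 p0S xp0] xg]] : exists x : 'I_n.+1 * bool -> R,
    (exists2 p, p \in log_index blk & x p != 0) /\
    forall i,
      \sum_(p in log_index blk) x p * log_coord blk w (g i) p \is a Num.int.
  apply: integral_functional => //; apply/eqP.
  by rewrite -(eqn_add2r r.+1) (card_log_index blk_surj) qr.
pose h X := \sum_(p in log_index blk) x p * log_coord blk w X p.
have Hint : H `<=` [set X : 'M[R[i]]_n.+1 |
    (forall i, X i i != 0) /\ h X \is a Num.int].
  apply: Hind => [i|X Y HX HY [Xd hX] [Yd hY]].
    by split=> [j|]; [apply: (block_ltrig_diag_neq0 _ (Hb _ (Hg i))) | apply: xg].
  have [Xb Yb] := (Hb _ HX, Hb _ HY); split.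
    by move=> i; rewrite (block_ltrig_mul_diag _ Xb Yb) mulf_neq0.
  suff -> : h (X *m Y) = h X + h Y by exact: rpredD hX hY.
  rewrite /h -big_split /=; apply: eq_bigr => p _.
  by rewrite (log_coordM _ _ Xb Yb Xd Yd (Hcomm _ _ HX HY)) mulrDr.
have [X0 [X0H X0b X0d X00 hX0]] := log_coord_half Hb Eb EH Ew p0S xp0.
pose X z := \sum_i y z i 0 *: E i.
(* The chart reaches X0 w because X0 keeps the first coordinate of w. *)
have [z0 yz0] : exists z, y z = X0 *m w.
  by apply: y_surj; apply: block_ltrig_row0 X0b X00.
have Xz0 : X z0 = X0 by rewrite /X yz0 -Ecoord.
have hcont : {for z0, continuous (h \o X)}.
  have Xcont : continuous_mx_at z0 X.
    move=> i j; apply: eq_continuous_at (fun z => summxE _ _ _ _ _) _.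
    apply: continuous_at_sum => k _.
    apply: eq_continuous_at (fun z => mxE _ _ _ _) _.
    by apply: cvgM; [exact: y_cont | exact: cvg_cst].
  apply: cvg_big => [|p _]; first exact: add_continuous.
  apply: cvgM; first exact: cvg_cst.
  by apply: continuous_log_coord => // i; rewrite Xz0.
have half_nbhs : nbhs (h (X z0)) `]0, 1[%classic.
  rewrite Xz0 /h hX0; apply: near_in_itvoo.
  by rewrite in_itv /=; apply/andP; split; lra.
have [s Ss /=] := dense_continuous_at S_dense hcont half_nbhs.
have [Y HY ys] := yS s Ss; have -> : X s = Y.
  by rewrite /X ys -Ecoord // => Z HZ; apply: Hcomm.
have /intrP[m ->] := (Hint Y HY).2.
by rewrite in_itv /= ltr0z ltrz1; lia.
Qed.

(** * Reduction of the affine statement *)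

Definition block_of (r m : nat) (eta : 'I_r -> nat)
    (sum_eta : (\sum_(k < r) eta k)%N = m) (i : 'I_m) : 'I_r :=
  tagnat.sig1 (cast_ord (esym sum_eta) i).

Lemma block_of_surj (r m : nat) (eta : 'I_r -> nat)
    (sum_eta : (\sum_(k < r) eta k)%N = m) k :
  (0 < eta k)%N -> exists i, block_of sum_eta i = k.
Proof.
move=> eta_gt0; exists (cast_ord sum_eta (tagnat.Rank k (Ordinal eta_gt0))).
by rewrite /block_of cast_ord_comp cast_ord_id tagnat.Rank1K.
Qed.

Lemma KK_block_ltrig (R : realType) (r m : nat) (eta : 'I_r -> nat)
    (sum_eta : (\sum_(k < r) eta k)%N = m) (M : 'M[R[i]]_m) :
  KK sum_eta M -> block_ltrig (block_of sum_eta) M.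
Proof.
case: _ / sum_eta M => M [B [TB ->]]; rewrite castmx_id /block_of /=.
have Btrig : is_trig_mx (\mxdiag_k B k).
  apply/is_trig_mxblockP; split=> [i j lt_ij|i].
    by case: eqP lt_ij => // ->; rewrite ltnn.
  by rewrite eqxx conform_mx_id; case: (TB i).
split=> i j; rewrite !cast_ord_id.
  move=> nz; split; last first.
    by rewrite leqNgt; apply: contra nz => /(is_trig_mxP Btrig)->.
  by apply/eqP; apply: contraNT nz => /negPf nb; rewrite mxE nb mxE.
rewrite !mxE !eqxx !conform_mx_id.
move: (tagnat.sig2 i) (tagnat.sig2 j); move: (tagnat.sig1 i) (tagnat.sig1 j).
by move=> k k' a b eq_k; case: _ / eq_k b => b; case: (TB k).
Qed.

Section Conjugation.
Context {F : fieldType} {m : nat} (P : 'M[F]_m).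
Hypothesis P_unit : P \in unitmx.
Implicit Types A B : 'M[F]_m.

Definition conj_mx A : 'M[F]_m := invmx P *m A *m P.

Lemma conj_mxM A B : conj_mx (A *m B) = conj_mx A *m conj_mx B.
Proof. by rewrite /conj_mx !mulmxA mulmxK. Qed.

Lemma conj_mx_app A (u : 'cV[F]_m) :
  conj_mx A *m (invmx P *m u) = invmx P *m (A *m u).
Proof. by rewrite /conj_mx !mulmxA mulmxK. Qed.

Lemma conj_mx_unit A : A \in unitmx -> conj_mx A \in unitmx.
Proof. by move=> A_unit; rewrite !unitmx_mul unitmx_inv P_unit A_unit. Qed.

End Conjugation.

Section Phi.
Context {R : realType} {n : nat}.
Implicit Types (f g : MA R n) (v : 'cV[R[i]]_n).

Lemma Phi_comp f g : Phi (aff_comp f g) = Phi f *m Phi g.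
Proof.
by rewrite /Phi mulmx_block !mul1mx !mul0mx !mulmx0 !mulmx1 !addr0 add0r addrC.
Qed.

Lemma Phi_app f v : Phi f *m col_mx 1%:M v = col_mx 1%:M (aff_app f v).
Proof. by rewrite /Phi mul_block_col !mul1mx !mul0mx mulmx1 addr0 addrC. Qed.

Lemma Phi_row0 f : row_mx 1%:M 0 *m Phi f = row_mx 1%:M 0.
Proof. by rewrite /Phi mul_row_block !mul1mx !mul0mx !addr0. Qed.

Lemma Phi_unit f : GA R n f -> Phi f \in unitmx.
Proof.
case=> g [fg _]; have /mulmx1_unit[] // : Phi f *m Phi g = 1%:M.
by rewrite -Phi_comp fg /Phi /= -scalar_mx_block.
Qed.

End Phi.

Unset Implicit Arguments.

Theorem corollary1p3 (R : realType) (n : nat) (n_ge1 : (1 <= n)%N)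
  (G : set (MA R n)) (abG : abelian_semigroup G)
  (r : nat) (r_bounds : (1 <= r <= n + 1)%N)
  (eta : 'I_r -> nat) (eta_gt0 : forall k, (0 < eta k)%N)
  (sum_eta : (\sum_(k < r) eta k)%N = (1 + n)%N)
  (P : 'M[R[i]]_(1 + n)) (GA_P : [set Phi f | f in GA R n] P)
  (G_sub_K : [set invmx P *m M *m P | M in [set Phi f | f in G]] `<=` KK sum_eta)
  (g : 'I_(2 * n - r + 1) -> MA R n)
  (g_inv : forall i, GA R n (g i))
  (g_comm : forall i j, aff_comp (g i) (g j) = aff_comp (g j) (g i))
  (G_gen : generated_by G (range g)) :
  ~ exists v : 'cV[R[i]]_n, dense (aff_orbit G v).
Proof.
case=> v Gv_dense; case: GA_P => p pGA defP.
have P_unit : P \in unitmx by rewrite -defP Phi_unit.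
pose C f := conj_mx P (Phi f).
pose w := invmx P *m col_mx 1%:M v.
pose y (z : 'cV[R[i]]_n) := invmx P *m col_mx 1%:M z.
have C_comp f h : C (aff_comp f h) = C f *m C h.
  by rewrite /C Phi_comp conj_mxM.
have Cw f : C f *m w = y (aff_app f v).
  by rewrite /C (conj_mx_app P_unit) Phi_app.
have Gg i : G (g i) by rewrite G_gen; apply: sub_gen_smallest; exists i.
have e0E (u : 'cV[R[i]]_(1 + n)) : row_mx 1%:M 0 *m u = usubmx u.
  by rewrite -[u in LHS]vsubmxK mul_row_col mul1mx mul0mx addr0.
have usubP (u : 'cV[R[i]]_(1 + n)) : usubmx (P *m u) = usubmx u.
  by rewrite -!e0E mulmxA -[in LHS]defP Phi_row0.
apply: (@no_dense_commuting_orbit R n r _ (block_of sum_eta) [set C f | f in G]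
  w (C \o g) _ _ y _ _ _ _ _ _ _ _ _ _ _ _ Gv_dense).
- by move=> k; apply: block_of_surj.
- move: r_bounds; lia.
- by rewrite addn1.
- move=> _ [f Gf <-]; apply: KK_block_ltrig; apply: G_sub_K.
  by exists (Phi f) => //; exists f.
- move=> _ _ [f Gf <-] [h Gh <-].
  by apply: etrans (esym (C_comp f h)) _; rewrite abG.2 //; apply: C_comp.
- by move=> i; apply: conj_mx_unit => //; apply: Phi_unit.
- by move=> i; exists (g i).
- move=> K Kg KM _ [f Gf <-].
  suff GK : G `<=` [set f | G f /\ K (C f)] by case: (GK f Gf).
  rewrite {1}G_gen; apply: smallest_sub => [f1 f2 [G1 K1] [G2 K2]|_ [i _ <-]].
    split; first exact: abG.1.
    by rewrite C_comp; apply: KM => //; [exists f1 | exists f2].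
  by split; [exact: Gg | exact: Kg].
- move=> c cH; suff c0 : c *m invmx P = 0.
    by rewrite -[c](mulmxKV P_unit) c0 mul0mx.
  apply: (dense_affine_functional Gv_dense) => _ [f Gf <-].
  by rewrite -mulmxA -/(y _) -Cw; apply: cH; exists f.
- move=> z; apply: continuous_mx_mul; first exact: continuous_mx_cst.
  exact: continuous_col_mx1.
- move=> u u0; exists (dsubmx (P *m u)).
  suff Pu : col_mx 1%:M (dsubmx (P *m u)) = P *m u by rewrite /y Pu mulKmx.
  have usubw : usubmx w = 1%:M by rewrite -usubP mulKVmx // col_mxKu.
  rewrite -[RHS]vsubmxK usubP -usubw; congr col_mx.
  apply/matrixP => i j; rewrite !ord1 [LHS]mxE [RHS]mxE.
  have -> : lshift n 0 = ord0 :> 'I_(1 + n) by apply: (@ord_inj (1 + n)).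
  exact: esym.
- by move=> _ [f Gf <-]; exists (C f); [exists f | rewrite Cw].
Qed.
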